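(* A frame $\mathcal{X}=\{x_i\}_{i=1}^m$ for $\mathbb{R}^n$ is scalable if and only if $$W(\ell_2(m)^+,\tilde{\mathcal{X}}^2)\cap V(\ell_2(m)^+,\mathcal{X}^{\perp})\neq\emptyset.$$
   Context: A sequence $\{x_i\}_{i=1}^m\subset\mathbb{R}^n$ is a frame for $\mathbb{R}^n$ if there are $0<A\le B<\infty$ with $A\|x\|^2\le\sum_{i=1}^m|\langle x,x_i\rangle|^2\le B\|x\|^2$ for all $x\in\mathbb{R}^n$; it is tight if one can take $A=B$. A frame $\{x_i\}_{i=1}^m$ is scalable if there exist non-negative constants $a_1,\dots,a_m$ such that $\{a_ix_i\}_{i=1}^m$ is a tight frame. Here $\ell_2(m)$ is $\mathbb{R}^m$ with the standard inner product, and $\ell_2(m)^+=\{a=(a_1,\dots,a_m)\in\ell_2(m): a_i\ge0\text{ for all }i\}$. For $u,v\in\ell_2(m)$, $u\bullet v=(u(1)v(1),\dots,u(m)v(m))$ and $u^2=u\bullet u$. For $j\in\{1,\dots,n\}$, $u_j=(x_1(j),x_2(j),\dots,x_m(j))\in\ell_2(m)$ is the $j$-th row of the $n\times m$ matrix with columns $x_1,\dots,x_m$. Set $\tilde{\mathcal{X}}=\{u_j: 1\le j\le n\}$, $\tilde{\mathcal{X}}^2=\{u^2:u\in\tilde{\mathcal{X}}\}$, $\mathcal{X}^{\perp}=\{u_i\bullet u_j: 1\le i\ne j\le n\}$, $$W(\ell_2(m)^+,\tilde{\mathcal{X}}^2)=\{a\in\ell_2(m)^+:\langle a,u^2\rangle=1\text{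 for all }u\in\tilde{\mathcal{X}}\},$$ $$V(\ell_2(m)^+,\mathcal{X}^{\perp})=\{a\in\ell_2(m)^+:\langle a,u\rangle=0\text{ for all }u\in\mathcal{X}^{\perp}\}.$$ *)

(* Defs.v *)
From mathcomp Require Import all_boot all_order all_algebra.
From mathcomp Require Import classical_sets reals.

Set Implicit Arguments.
Unset Strict Implicit.
Unset Printing Implicit Defensive.

Import Order.TTheory GRing.Theory Num.Theory.
Local Open Scope classical_set_scope.
Local Open Scope ring_scope.

(* R^n and ell_2(m) are both represented by row vectors, so the i-th coordinate
   of v is v 0 i. *)

Definition inner (R : realType) (n : nat) (u v : 'rV[R]_n) : R :=
  \sum_(i < n) u 0 i * v 0 i.

(* Euclidean norm; the library's norm on matrices is the sup norm. *)
Definition enorm (R : realType) (n : nat) (u : 'rV[R]_n) : R :=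
  Num.sqrt (inner u u).

Definition frame_bounds (R : realType) (m n : nat) (A B : R)
    (x : 'I_m -> 'rV[R]_n) : Prop :=
  0 < A <= B /\
  forall y : 'rV[R]_n,
    A * enorm y ^+ 2 <= \sum_(i < m) `|inner y (x i)| ^+ 2 <= B * enorm y ^+ 2.

Definition is_frame (R : realType) (m n : nat) (x : 'I_m -> 'rV[R]_n) : Prop :=
  exists A B : R, frame_bounds A B x.

Definition is_tight_frame (R : realType) (m n : nat)
    (x : 'I_m -> 'rV[R]_n) : Prop :=
  exists A : R, frame_bounds A A x.

Definition scalable_frame (R : realType) (m n : nat) (x : 'I_m -> 'rV[R]_n) : Prop :=
  exists a : 'I_m -> R,
    (forall i, 0 <= a i) /\ is_tight_frame (fun i => a i *: x i).

Definition bullet (R : realType) (m : nat) (u v : 'rV[R]_m) : 'rV[R]_m :=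
  map2_mx *%R u v.

Definition frame_matrix (R : realType) (m n : nat) (x : 'I_m -> 'rV[R]_n) :
    'M[R]_(n, m) :=
  \matrix_(j < n, i < m) x i 0 j.

Definition coord_row (R : realType) (m n : nat) (x : 'I_m -> 'rV[R]_n)
    (j : 'I_n) : 'rV[R]_m :=
  row j (frame_matrix x).

Definition Xtilde (R : realType) (m n : nat) (x : 'I_m -> 'rV[R]_n) :
    set 'rV[R]_m :=
  [set u | exists j : 'I_n, u = coord_row x j].

Definition Xtilde_sq (R : realType) (m n : nat) (x : 'I_m -> 'rV[R]_n) :
    set 'rV[R]_m :=
  [set bullet u u | u in Xtilde x].

Definition Xperp (R : realType) (m n : nat) (x : 'I_m -> 'rV[R]_n) :
    set 'rV[R]_m :=
  [set v | exists i j : 'I_n,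
             i != j /\ v = bullet (coord_row x i) (coord_row x j)].

Definition l2_pos (R : realType) (m : nat) : set 'rV[R]_m :=
  [set a : 'rV[R]_m | forall i : 'I_m, 0 <= a 0 i].
Arguments l2_pos : clear implicits.

Definition W (R : realType) (m : nat) (P S : set 'rV[R]_m) : set 'rV[R]_m :=
  [set a | P a /\ forall v, S v -> inner a v = 1].

Definition V (R : realType) (m : nat) (P S : set 'rV[R]_m) : set 'rV[R]_m :=
  [set a | P a /\ forall v, S v -> inner a v = 0].

(* Main.v *)
(** Scaling a frame by [a i] weights its quadratic form by [b i = a i ^ 2], so
    scalability means that, after normalizing the frame constant to 1, some
    nonnegative weights [b] satisfy [\sum_i b i * <y, x i>^2 = |y|^2] for all
    [y].  By polarization this says that the weighted Gram matrix of the
    coordinate rows is the identity: its diagonal entries are the conditions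
    defining [W], its off-diagonal entries those defining [V]. *)
Require Import Defs.
From mathcomp Require Import all_boot all_order all_algebra.
From mathcomp Require Import classical_sets reals.
From mathcomp Require Import lra.

Import Order.TTheory GRing.Theory Num.Theory.
Local Open Scope classical_set_scope.
Local Open Scope ring_scope.

Lemma innerDl (R : realType) (n : nat) (u v w : 'rV[R]_n) :
  inner (u + v) w = inner u w + inner v w.
Proof.
by rewrite /inner -big_split; apply: eq_bigr => i _; rewrite mxE mulrDl.
Qed.

Lemma innerZr (R : realType) (n : nat) (c : R) (u v : 'rV[R]_n) :
  inner u (c *: v) = c * inner u v.
Proof.
by rewrite /inner mulr_sumr; apply: eq_bigr => i _; rewrite mxE mulrCA.
Qed.

Lemma inner_deltal (R : realType) (n : nat) (j : 'I_n) (u : 'rV[R]_n) :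
  inner (delta_mx 0 j) u = u 0 j.
Proof.
rewrite /inner (bigD1 j) //= mxE !eqxx mul1r big1 ?addr0 // => i /negbTE ij.
by rewrite mxE ij andbF mul0r.
Qed.

Lemma inner_sqr (R : realType) (n : nat) (u v : 'rV[R]_n) :
  inner u v ^+ 2 = \sum_j \sum_k u 0 j * u 0 k * (v 0 j * v 0 k).
Proof.
rewrite expr2 {1}/inner mulr_suml; apply: eq_bigr => j _.
by rewrite mulr_sumr; apply: eq_bigr => k _; rewrite mulrACA.
Qed.

Lemma enorm_sqr (R : realType) (n : nat) (u : 'rV[R]_n) :
  enorm u ^+ 2 = inner u u.
Proof. by rewrite sqr_sqrtr // sumr_ge0 // => i _; exact: sqr_ge0. Qed.

(** With equal bounds the two frame inequalities collapse to one equality, and over the reals the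
    absolute value disappears under the square. *)
Lemma is_tight_frameP (R : realType) (m n : nat) (x : 'I_m -> 'rV[R]_n) :
  is_tight_frame x <->
  exists2 A : R, 0 < A & forall y, \sum_(i < m) inner y (x i) ^+ 2 = A * inner y y.
Proof.
split=> [[A [/andP[A0 _] Ax]]|[A A0 Ax]]; exists A => //.
  move=> y; apply/eqP; rewrite eq_sym eq_le; have := Ax y.
  by under eq_bigr do rewrite real_normK ?num_real //; rewrite enorm_sqr.
split=> [|y]; first by rewrite A0 lexx.
under eq_bigr do rewrite real_normK ?num_real //.
by rewrite enorm_sqr Ax lexx.
Qed.

Lemma weighted_parseval_gram (R : realType) (m n : nat) (b : 'I_m -> R)
    (x : 'I_m -> 'rV[R]_n) :
  (forall y, \sum_(i < m) b i * inner y (x i) ^+ 2 = inner y y) <->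
  (forall j k, \sum_(i < m) b i * (x i 0 j * x i 0 k) = (j == k)%:R).
Proof.
split=> [bx j k|gram y].
  have diag l : \sum_(i < m) b i * x i 0 l ^+ 2 = 1.
    have := bx (delta_mx 0 l); rewrite inner_deltal mxE !eqxx /= mulr1n => <-.
    by under [RHS]eq_bigr do rewrite inner_deltal.
  have [<-|jk] := eqVneq j k; first by rewrite -[RHS](diag j).
  (* Polarization: on the sum of two distinct basis vectors the identity reads 1 + 2g + 1 = 2, where
     g is the off-diagonal entry. *)
  have := bx (delta_mx 0 j + delta_mx 0 k).
  rewrite !innerDl !inner_deltal !mxE !eqxx (negbTE jk) eq_sym (negbTE jk) /=.
  under eq_bigr => i _.
    rewrite innerDl !inner_deltal sqrrD !mulrDr; over.
  by rewrite !big_split /= !diag => polar; lra.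
(* Expand the squares and move the sum over the frame index innermost: it becomes a Gram entry, so
   only the terms with [k = j] survive. *)
under eq_bigr do rewrite inner_sqr mulr_sumr.
rewrite exchange_big; apply: eq_bigr => j _ /=.
under eq_bigr do rewrite mulr_sumr.
rewrite exchange_big /=.
under eq_bigr => k _.
  under eq_bigr do rewrite mulrCA.
  rewrite -mulr_sumr gram; over.
rewrite (bigD1 j) //= eqxx mulr1 big1 ?addr0 // => k kj.
by rewrite eq_sym (negbTE kj) mulr0.
Qed.

(** Pairing [b] with the bullet product of rows [j] and [k] gives the weighted Gram entry at
    [(j, k)]; [j = k] covers [Xtilde_sq x], and [j != k] covers [Xperp x]. *)
Lemma WV_gram (R : realType) (m n : nat) (x : 'I_m -> 'rV[R]_n) (b : 'rV[R]_m) :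
  (W (l2_pos R m) (Xtilde_sq x) `&` V (l2_pos R m) (Xperp x)) b <->
  (forall i, 0 <= b 0 i) /\
  (forall j k, \sum_(i < m) b 0 i * (x i 0 j * x i 0 k) = (j == k)%:R).
Proof.
have innerE j k : inner b (bullet (coord_row x j) (coord_row x k)) =
    \sum_(i < m) b 0 i * (x i 0 j * x i 0 k).
  by apply: eq_bigr => i _; rewrite !mxE.
split=> [[[b0 bW] [_ bV]]|[b0 gram]].
  split=> // j k; rewrite -innerE; have [<-|jk] := eqVneq j k.
    by apply: bW; exists (coord_row x j) => //; exists j.
  by apply: bV; exists j, k.
split; split=> // v.
- by move=> [_ [j ->] <-]; rewrite innerE gram eqxx.
- by move=> [j [k [/negbTE jk ->]]]; rewrite innerE gram jk.
Qed.

Theorem theorem4p13 (R : realType) (m n : nat) (x : 'I_m -> 'rV[R]_n)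
    (hx : is_frame x) :
  scalable_frame x <-> W (l2_pos R m) (Xtilde_sq x) `&` V (l2_pos R m) (Xperp x) !=set0.
Proof.
split=> [[a [a0 /is_tight_frameP[A A0 aA]]]|[b /WV_gram[b0 /weighted_parseval_gram bx]]].
  (* Dividing the squared scalings by the tight bound [A] normalizes the frame constant to 1. *)
  exists (\row_i (a i ^+ 2 / A)); apply/WV_gram; split=> [i|].
    by rewrite mxE divr_ge0 ?sqr_ge0 ?ltW.
  apply/weighted_parseval_gram => y; apply: (mulfI (lt0r_neq0 A0)).
  rewrite -aA mulr_sumr; apply: eq_bigr => i _.
  by rewrite mxE innerZr exprMn mulrA [A * _]mulrC divfK ?lt0r_neq0.
(* Square roots turn the weights back into scalings; the resulting tight bound is 1. *)
exists (fun i => Num.sqrt (b 0 i)); split=> [i|]; first exact: sqrtr_ge0.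
apply/is_tight_frameP; exists 1 => // y; rewrite mul1r -bx.
by apply: eq_bigr => i _; rewrite innerZr exprMn sqr_sqrtr.
Qed.
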